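(* Consider a FIFO system offering a $c$-Lipschitz service curve $\beta$ to an aggregate of $M$ flows, where, as soon as a packet starts to be transmitted, it is transmitted at rate $c$. Assume that every flow $i\in\{1,\dots,M\}$ conforms to either the Sliding interval $(\tau_i,K_i)$ constraint or the Fixed interval $(\tau_i,K_i)$ constraint, and has maximum packet size $L_i^{\max}$. For each flow $i$ define $\alpha_{\mathrm{pkt},i}(0)=0$ and, for $t>0$, $$\alpha_{\mathrm{pkt},i}(t)=K_i\Big\lceil \tfrac{t}{\tau_i}\Big\rceil\ \text{(Sliding interval)},\qquad \alpha_{\mathrm{pkt},i}(t)=K_i\Big\lceil \tfrac{t}{\tau_i}\Big\rceil+K_i\ \text{(Fixed interval)},$$ and for each flow $f$ let $$\Delta^{\mathrm{pkt}}_f=h\Big(\sum_{i=1}^{M}L_i^{\max}\alpha_{\mathrm{pkt},i}^{+}-L_f^{\max},\,\beta\Big)+\frac{L_f^{\max}}{c}.$$ Then, for every flow $f$ and every $\varepsilon>0$, there exists a simulation trace of this system (with every flow satisfying its own Sliding or Fixed interval constraint and its maximum packet size) in which a packet of flow $f$ experiences a response time in the interval $[\Delta^{\mathrm{pkt}}_f-\varepsilon,\ \Delta^{\mathrm{pkt}}_f]$.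
   Context: Functions. $\mathcal F^0_{\mathrm{inc}}$ is the set of wide-sense increasing functions $w:[0,\infty)\to[0,\infty]$ with $w(0)=0$. $w^+$ denotes the right limit of $w$. The lower pseudo-inverse is $w^{\downarrow}(x)=\inf\{s\ge 0: w(s)\ge x\}$. The horizontal deviation is $h(w',w)=\sup_{t\ge 0}\{w^{\downarrow}(w'(t))-t\}$. $w$ is $c$-Lipschitz if $|w(t_2)-w(t_1)|\le c|t_2-t_1|$ for all $t_1,t_2\ge0$. FIFO system and trace. Packets are numbered $n=1,2,\dots$ in order of arrival, all flows together; packet $n$ has length $l_n>0$ (bits) and arrival time $A_n\ge0$, $A_n\le A_{n+1}$ (simultaneous arrivals may be ordered arbitrarily), and belongs to one flow. All bits of a packet arrive at the same instant (packetized input). Packet $n$ starts transmission at time $Q_n\ge A_n$, with $Q_n\le Q_{n+1}$ (FIFO), and is transmitted without preemption at constant rate $c>0$, leaving at $D_n=Q_n+l_n/c$ (at most one packet is in transmission at a time). The response time (delay) of packet $n$ is $D_n-A_n$. Let $\mathcal A(t)$ (resp. $\mathcal D(t)$) be the cumulative number of bits arrived at (resp. departed from) the system until time $t$ (excluded). The system offers service curve $\beta\in\mathcal F^0_{\mathrm{inc}}$ if for every $t\ge 0$ there is $s\in[0,t]$ with $\mathcal D(t)\ge\beta(t-s)+\mathcal A(s)$. A simulation trace is a (finite or infinite) packet sequence, with flow membership, lengths, arrival times and transmission start times, satisfying all these requirements. Interval constraints ($\tau>0$, $K$ a positive integer). Let $N(t)$ be the number of packets of a flow arrived until time $t$ (excluded).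 The flow conforms to Sliding interval $(\tau,K)$ if $N(t+\tau)-N(t)\le K$ for all $t\ge0$. It conforms to Fixed interval $(\tau,K)$ if there is an offset $\theta\ge0$ such that $N(\theta)=N(0)=0$ and $N(\theta+(i+1)\tau)-N(\theta+i\tau)\le K$ for all integers $i\ge0$.
   Formalization: The formal theorem additionally assumes that the bound Δ_f^pkt is finite; if it is infinite (e.g. β = 0), no real response time can lie in [Δ−ε, Δ], so the claim as written fails there. *)

(* Defs.v *)
From HB Require Import structures.
From mathcomp Require Import all_boot all_order all_algebra.
From mathcomp Require Import all_classical all_reals all_analysis.

Set Implicit Arguments.
Unset Strict Implicit.
Unset Printing Implicit Defensive.

Import Order.TTheory GRing.Theory Num.Theory.
Import numFieldNormedType.Exports.

Local Open Scope classical_set_scope.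
Local Open Scope ring_scope.

(* A function [0,oo) -> [0,oo] is encoded as a map R -> \bar R of which only
   the values at nonnegative arguments are ever used. *)
Section curves.
Variable R : realType.
Implicit Types (w : R -> \bar R) (c t : R) (x : \bar R).

Definition Finc0 : set (R -> \bar R) :=
  [set w | [/\ w 0 = 0%E,
               (forall t, 0 <= t -> (0 <= w t)%E) &
               (forall s t, 0 <= s -> s <= t -> (w s <= w t)%E)]].

(* In \bar R, `|+oo - +oo| = +oo; with w 0 = 0 this makes w finite. *)
Definition lipschitz_curve c w : Prop :=
  forall t1 t2, 0 <= t1 -> 0 <= t2 ->
    (`|w t2 - w t1| <= (c * `|t2 - t1|)%:E)%E.

Definition right_limit w : R -> \bar R := fun t => lim (w u @[u --> t^'+]).

Definition lower_pseudo_inverse w x : \bar R :=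
  ereal_inf [set s%:E | s in [set s : R | 0 <= s /\ (x <= w s)%E]].

Definition hdev w' w : \bar R :=
  ereal_sup [set (lower_pseudo_inverse w (w' t) - t%:E)%E
            | t in [set t : R | 0 <= t]].

End curves.

Section traces.
Variables (R : realType) (M : nat).

(* Packets are numbered from 0; trace_size is the number of packets, None
   standing for an infinite trace. The other fields are meaningful only at the
   indices of actual packets (see is_packet). *)
Record trace := Trace {
  trace_size : option nat;
  flow_of : nat -> 'I_M;
  len : nat -> R;
  arrival : nat -> R;
  start : nat -> R }.

Variables (c : R) (T : trace).

Definition is_packet (n : nat) : bool :=
  if trace_size T is Some N then (n < N)%N else true.

Definition departure (n : nat) : R := start T n + len T n / c.

Definition response_time (n : nat) : R := departure n - arrival T n.

Definition fifo_trace : Prop :=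
  (forall n, is_packet n ->
     [/\ 0 < len T n, 0 <= arrival T n & arrival T n <= start T n]) /\
  (forall n, is_packet n.+1 ->
     [/\ arrival T n <= arrival T n.+1,
         start T n <= start T n.+1 &
         departure n <= start T n.+1]).

Definition cumul_arrived (t : R) : \bar R :=
  (\sum_(n <oo | is_packet n && (arrival T n < t)%R) (len T n)%:E)%E.

(* Output is not packetized: the bits of packet n leave continuously, at rate
   c, during [start n, departure n]. *)
Definition cumul_departed (t : R) : \bar R :=
  (\sum_(n <oo | is_packet n)
     (Num.min (len T n) (Num.max 0 (c * (t - start T n))))%:E)%E.

Definition offers_service_curve (beta : R -> \bar R) : Prop :=
  forall t : R, 0 <= t -> exists2 s : R, 0 <= s <= t &
    (beta (t - s)%R + cumul_arrived s <= cumul_departed t)%E.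

Definition npackets (i : 'I_M) (t : R) : \bar R :=
  (\sum_(n <oo | [&& is_packet n, flow_of T n == i & (arrival T n < t)%R]) 1)%E.

End traces.

Variant interval_kind := Sliding | Fixed.

(* Under a constraint below, N is finite at all times: N starts at 0 and grows
   by at most K per interval of length tau. The junk value +oo - +oo = -oo thus
   cannot validate the inequalities. *)
Definition conforms (R : realType) (k : interval_kind) (tau : R) (K : nat)
    (N : R -> \bar R) : Prop :=
  match k with
  | Sliding =>
      forall t : R, 0 <= t -> (N (t + tau)%R - N t <= K%:R%:E)%E
  | Fixed =>
      exists2 theta : R, 0 <= theta &
        [/\ N theta = 0%E, N 0 = 0%E &
            forall i : nat,
              (N (theta + i.+1%:R * tau)%R - N (theta + i%:R * tau)%R
                 <= K%:R%:E)%E]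
  end.

Definition alpha_pkt (R : realType) (k : interval_kind) (tau : R) (K : nat)
    (t : R) : \bar R :=
  if t == 0 then 0%E else
  match k with
  | Sliding => (K%:R * (Num.ceil (t / tau))%:~R)%:E
  | Fixed => (K%:R * (Num.ceil (t / tau))%:~R + K%:R)%:E
  end.

Definition Delta_pkt (R : realType) (M : nat) (c : R) (beta : R -> \bar R)
    (kind : 'I_M -> interval_kind) (tau : 'I_M -> R) (K : 'I_M -> nat)
    (Lmax : 'I_M -> R) (f : 'I_M) : \bar R :=
  (hdev (fun t => \sum_(i < M)
                    (Lmax i)%:E * right_limit (alpha_pkt (kind i) (tau i) (K i)) t
                  - (Lmax f)%:E) beta
   + (Lmax f / c)%:E)%E.

(* Main.v *)
(* Take t0 almost attaining the horizontal deviation H, and let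
   x = beta^down(W(t0) - L_f), where W = sum_i L_i alpha_i^+.  The packets are
   sent so that all W(t0) bits arrive within [T0 - t0 - d, T0], with d small:
   flow i sends bursts of K_i maximal packets at T0, T0 - tau_i, T0 - 2 tau_i,
   ..., going backwards so that a packet of flow f can be the last one whatever
   t0 is; a Fixed flow sends one more burst at T0 - t0 - d.  The server works
   greedily at rate c, except that the last packet, of flow f, does not start
   before T0 - t0 - d + x; its response time is then at least x - t0 - d + L_f/c.
   The service curve holds as beta is c-Lipschitz: a guarantee
   beta(t - s) + A(s) <= D(t) persists while bits leave at rate c.
   If the greedy discipline makes the last packet start even later, then the
   server has been busy since the arrival, at time a, of some packet, so that
   the last packet waits (bits arrived in [a, T0] before it) / c - (T0 - a),
   which is at most (W(u) - L_f) / c - u with u = T0 - a, hence at most H, since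
   beta^down(y) >= y / c. *)

Require Import Defs.
From HB Require Import structures.
From mathcomp Require Import all_boot all_order all_algebra.
From mathcomp Require Import all_classical all_reals all_analysis.
From mathcomp Require Import lra.

Set Implicit Arguments.
Unset Strict Implicit.
Unset Printing Implicit Defensive.

Import Order.TTheory GRing.Theory Num.Theory.
Import numFieldNormedType.Exports.

Local Open Scope classical_set_scope.
Local Open Scope ring_scope.

(** * Right limits of the packet arrival curves *)

Definition burst_size (R : realType) (k : interval_kind) (tau : R) (K : nat)
    (t : R) : nat :=
  K * ((if k is Fixed then 1 else 0) + (Num.truncn (t / tau)).+1).

(** Just to the right of [t] the ceiling of [u / tau] is the floor of [t / tau] plus one, even if
    [tau] divides [t]; at [t = 0] a burst is thus already counted. *)
Lemma right_limit_alpha_pkt (R : realType) (k : interval_kind) (tau : R)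
    (K : nat) (t : R) : 0 < tau -> 0 <= t ->
  right_limit (alpha_pkt k tau K) t = (burst_size k tau K t)%:R%:E.
Proof.
move=> tau0 t0; rewrite /burst_size.
have /andP[] := truncn_itv (divr_ge0 t0 (ltW tau0)).
move: (Num.truncn _) => n nt tn; apply: lim_near_cst => //; near=> u.
have tu : t < u by near: u; exact: nbhs_right_gt.
have un : u <= n.+1%:R * tau.
  by near: u; apply: nbhs_right_le; rewrite -ltr_pdivrMr.
rewrite /alpha_pkt gt_eqF ?(le_lt_trans t0) //.
have -> : Num.ceil (u / tau) = n.+1%:Z.
  apply: ceil_def; rewrite ler_pdivrMr // un andbT.
  rewrite ltr_pdivlMr // (le_lt_trans _ tu) //.
  by rewrite intS addrAC subrr add0r -ler_pdivlMr.
rewrite -pmulrn.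
by case: k; rewrite natrM ?add0n // add1n -[n.+2]addn1 natrD mulrDr mulr1.
Unshelve. all: by end_near. Qed.

(** * Lipschitz service curves and their pseudo-inverses *)

Lemma lipschitz_fin (R : realType) (c : R) (beta : R -> \bar R) (t : R) :
  Finc0 beta -> lipschitz_curve c beta -> 0 <= t -> beta t \is a fin_num.
Proof.
move=> [b0 bge0 _] lip t0; have := lip 0 t (lexx _) t0.
rewrite b0 sube0 gee0_abs ?bge0// fin_numElt => /le_lt_trans -> //.
  by rewrite (lt_le_trans _ (bge0 _ t0)) // ltNyr.
by rewrite ltry.
Qed.

Lemma lipschitz_fine (R : realType) (c : R) (beta : R -> \bar R) (s t : R) :
  Finc0 beta -> lipschitz_curve c beta -> 0 <= s -> s <= t ->
  fine (beta t) - fine (beta s) <= c * (t - s).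
Proof.
move=> bF lip s0 st; have t0 := le_trans s0 st.
have := lip s t s0 t0.
rewrite -(fineK (lipschitz_fin bF lip s0)) -(fineK (lipschitz_fin bF lip t0)).
rewrite -EFinB abse_EFin lee_fin (ger0_norm (_ : 0 <= t - s)) ?subr_ge0 //.
exact: le_trans (ler_norm _).
Qed.

(** Starting from 0 with slope at most [c], [beta] needs at least a time [y / c] to reach [y]. *)
Lemma lower_pseudo_inverse_ge (R : realType) (c : R) (beta : R -> \bar R)
    (y : R) : 0 < c -> Finc0 beta -> lipschitz_curve c beta ->
  ((y / c)%:E <= lower_pseudo_inverse beta y%:E)%E.
Proof.
move=> c0 bF lip; apply: le_ereal_inf_tmp => _ [s [s0 ys] <-].
rewrite lee_fin ler_pdivrMr // mulrC.
have := lipschitz_fine bF lip (lexx 0) s0.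
have [-> _ _] := bF; rewrite /= !subr0; apply: le_trans.
by rewrite -lee_fin fineK // (lipschitz_fin bF lip s0).
Qed.

Lemma lower_pseudo_inverse_ge0 (R : realType) (beta : R -> \bar R)
    (y : \bar R) : (0 <= lower_pseudo_inverse beta y)%E.
Proof. by apply: le_ereal_inf_tmp => _ [s [s0 _] <-]; rewrite lee_fin. Qed.

(** Continuity gives the endpoint [t = x] too; this is what lets the last packet be held back for a
    time [x]. *)
Lemma beta_lower_pseudo_inverse_le (R : realType) (c : R)
    (beta : R -> \bar R) (x y t : R) :
  0 < c -> Finc0 beta -> lipschitz_curve c beta -> 0 <= y ->
  lower_pseudo_inverse beta y%:E = x%:E -> 0 <= t -> t <= x ->
  fine (beta t) <= y.
Proof.
move=> c0 bF lip y0 yx t0 tx; rewrite leNgt; apply/negP => ybt.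
have bt := lipschitz_fine bF lip (lexx 0) t0.
have [b0 _ _] := bF; rewrite b0 /= !subr0 in bt.
(* Going back by this much, the curve loses at most [beta t - y], so it still reaches [y] at
   [s < t], against the infimum [x]. *)
pose s := t - (fine (beta t) - y) / c.
have s0 : 0 <= s.
  by rewrite subr_ge0 ler_pdivrMr // mulrC; lra.
have st : s < t by rewrite ltrBlDr ltrDl divr_gt0 ?subr_gt0.
have := lipschitz_fine bF lip s0 (ltW st).
rewrite opprB addrCA subrr addr0 mulrCA divff ?gt_eqF // mulr1 => ys.
have : (lower_pseudo_inverse beta y%:E <= s%:E)%E.
  apply: ereal_inf_lbound; exists s => //; split=> //.
  rewrite -(fineK (lipschitz_fin bF lip s0)) lee_fin; lra.
by rewrite yx lee_fin => xs; have := lt_le_trans st tx; rewrite ltNge xs.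
Qed.

Lemma nneseries_finite_support (R : realType) (P : pred nat)
    (F : nat -> \bar R) (N : nat) :
  (forall n, P n -> (n < N)%N) ->
  (\sum_(n <oo | P n) F n = \sum_(n < N | P n) F n)%E.
Proof.
move=> PN; apply: lim_near_cst => //; near=> n.
have Nn : (N <= n)%N by near: n; exact: nbhs_infty_ge.
rewrite (big_cat_nat (leq0n N) Nn) /= big_mkord.
rewrite [X in (_ + X)%E]big_nat_cond big_pred0 ?adde0 //.
move=> i; apply/negP => /andP[/andP[Ni _] /PN].
by rewrite ltnNge Ni.
Unshelve. all: by end_near. Qed.

(** * A FIFO server with floors on the start times *)

Section server.
Variables (R : realType) (M : nat) (c : R) (N : nat).
Variables (fl : nat -> 'I_M) (l a b : nat -> R).

(** The floor [b n] delays packet [n] on purpose; otherwise the server is greedy, and it is free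
    from time 0. *)
Fixpoint fifo_start (n : nat) : R :=
  Num.max (Num.max (a n) (b n))
    (if n is m.+1 then fifo_start m + l m / c else 0).

Definition fifo_server : trace R M := Trace (Some N) fl l a fifo_start.

Hypotheses (c_gt0 : 0 < c) (l_gt0 : forall n, 0 < l n).
Hypotheses (a_ge0 : forall n, 0 <= a n) (a_homo : forall n, a n <= a n.+1).

Let P (n : nat) : R := \sum_(m < n) l m.
Let arr (s : R) : R := \sum_(m < N | a m < s) l m.
Let dep (t : R) : R :=
  \sum_(m < N) Num.min (l m) (Num.max 0 (c * (t - fifo_start m))).

Lemma fifo_start_ge_arrival n : a n <= fifo_start n.
Proof. by case: n => [|n] /=; rewrite !le_max lexx. Qed.

Lemma fifo_start_ge_floor n : b n <= fifo_start n.
Proof. by case: n => [|n] /=; rewrite !le_max lexx ?orbT. Qed.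

Lemma fifo_start_ge_departure n : fifo_start n + l n / c <= fifo_start n.+1.
Proof. by rewrite /= !le_max lexx ?orbT. Qed.

Lemma fifo_start_ge0 n : 0 <= fifo_start n.
Proof. exact: le_trans (fifo_start_ge_arrival n). Qed.

Lemma fifo_start_ltS n : fifo_start n < fifo_start n.+1.
Proof.
by apply: lt_le_trans (fifo_start_ge_departure n); rewrite ltrDl divr_gt0.
Qed.

Lemma fifo_server_fifo : fifo_trace c fifo_server.
Proof.
split=> n _; split=> //=; first exact: fifo_start_ge_arrival.
- exact/ltW/fifo_start_ltS.
- exact: fifo_start_ge_departure.
Qed.

Lemma cumul_arrivedE s : cumul_arrived fifo_server s = (arr s)%:E.
Proof.
rewrite /cumul_arrived (@nneseries_finite_support _ _ _ N); last first.
  by move=> n /andP[].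
rewrite -sumEFin; apply: eq_bigl => i.
by rewrite /is_packet /= ltn_ord.
Qed.

Lemma cumul_departedE t : cumul_departed c fifo_server t = (dep t)%:E.
Proof.
rewrite /cumul_departed (@nneseries_finite_support _ _ _ N) //.
rewrite -sumEFin; apply: eq_bigl => i.
by rewrite /is_packet /= ltn_ord.
Qed.

Lemma npacketsE i t : npackets fifo_server i t =
  (\sum_(n < N | (fl n == i) && (a n < t)) 1)%:E.
Proof.
rewrite /npackets (@nneseries_finite_support _ _ _ N); last first.
  by move=> n /and3P[].
rewrite -sumEFin; apply: eq_bigl => n.
by rewrite /is_packet /= ltn_ord.
Qed.

Lemma arrival_homo : {homo a : m n / (m <= n)%N >-> m <= n}.
Proof. by apply: homo_leq => //; exact: le_trans. Qed.

(** Arrivals are sorted, so only packets of index below [n] arrive strictly before [a n]. *)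
Lemma arr_le n s : (n <= N)%N -> s <= a n -> arr s <= P n.
Proof.
move=> nN san; rewrite /P (big_ord_widen _ _ nN) /arr.
rewrite [leRHS](bigID (fun m : 'I_N => a m < s)) /= -[leLHS]addr0 lerD //.
  rewrite [leRHS](eq_bigl (fun m : 'I_N => a m < s)) // => m.
  apply: andb_idl => ams; rewrite ltnNge; apply/negP => nm.
  by have := lt_le_trans ams san; rewrite ltNge arrival_homo.
by apply: sumr_ge0 => m _; exact: ltW.
Qed.

Lemma arr_eq0 s : (forall n, s <= a n) -> arr s = 0.
Proof. by move=> sa; rewrite /arr big_pred0 // => m; rewrite ltNge sa. Qed.

Lemma dep_term_ge0 m t :
  0 <= Num.min (l m) (Num.max 0 (c * (t - fifo_start m))).
Proof. by rewrite le_min (ltW (l_gt0 _)) le_max lexx. Qed.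

Lemma dep_ge n t : (n <= N)%N ->
  (forall m, (m < n)%N -> fifo_start m + l m / c <= t) -> P n <= dep t.
Proof.
move=> nN Dt; rewrite /P (big_ord_widen _ _ nN) /dep.
rewrite [leRHS](bigID (fun m : 'I_N => (m < n)%N)) /= -[leLHS]addr0 lerD //.
  apply: ler_sum => m /Dt; rewrite -lerBrDl ler_pdivrMr // mulrC => h.
  by rewrite le_min lexx le_max h orbT.
by apply: sumr_ge0 => m _; exact: dep_term_ge0.
Qed.

Lemma departure_le n m : (m < n)%N -> fifo_start m + l m / c <= fifo_start n.
Proof.
move=> mn; apply: le_trans (fifo_start_ge_departure m) _.
elim: n mn => // n IH; rewrite ltnS leq_eqVlt => /orP[/eqP->//|/IH].
by move/le_trans; apply; exact/ltW/fifo_start_ltS.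
Qed.

Lemma dep_ge_in_service n t : (n < N)%N ->
  fifo_start n <= t -> t <= fifo_start n + l n / c ->
  P n + c * (t - fifo_start n) <= dep t.
Proof.
move=> nN Qt tD; rewrite /P (big_ord_widen _ _ (ltnW nN)) /dep.
rewrite [leRHS](bigID (fun m : 'I_N => (m < n)%N)) /= lerD //.
  apply: ler_sum => m /departure_le/le_trans/(_ Qt).
  rewrite -lerBrDl ler_pdivrMr // mulrC => h.
  by rewrite le_min lexx le_max h orbT.
rewrite (bigD1 (Ordinal nN)) ?ltnn //= -[leLHS]addr0 lerD //.
  rewrite le_min le_max lexx orbT andbT mulrC -ler_pdivlMr //.
  by rewrite lerBlDl.
by apply: sumr_ge0 => m _; exact: dep_term_ge0.
Qed.

(** The deadline of packet [m] is [E] minus the time to send packets [m] to [n - 1] back to back;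
    meeting it propagates along the recursion of [fifo_start]. *)
Lemma fifo_start_le E n : (n < N)%N ->
  (forall m, (m <= n)%N ->
     a m <= E - (P n - P m) / c /\ b m <= E - (P n - P m) / c) ->
  fifo_start n <= E.
Proof.
move=> nN abE; suff H m : (m <= n)%N -> fifo_start m <= E - (P n - P m) / c.
  by have := H n (leqnn _); rewrite subrr mul0r subr0.
elim: m => [|m IH] mn /=; have [am bm] := abE _ mn.
  by rewrite !ge_max am bm (le_trans (a_ge0 0)).
rewrite !ge_max am bm /=.
have -> : P m.+1 = P m + l m by rewrite /P big_ord_recr.
by have := IH (ltnW mn); rewrite !mulrBl mulrDl; lra.
Qed.

(** * The service guarantee of the server *)

Section service.
Variable beta : R -> \bar R.
Hypotheses (betaF : Finc0 beta) (beta_lip : lipschitz_curve c beta).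

(** An amount [p] replaces the departures at [t], so that the guarantee can be carried through a
    busy period. *)
Let good (t p : R) : Prop :=
  exists2 s : R, 0 <= s <= t & fine (beta (t - s)) + arr s <= p.

(** The same [s] serves: [beta] grows by at most [c * h], the amount sent meanwhile. *)
Lemma good_lipschitz t h p : 0 <= h -> good t p -> good (t + h) (p + c * h).
Proof.
move=> h0 [s /andP[s0 st] sp]; exists s.
  by rewrite s0 (le_trans st) ?lerDl.
have ts0 : 0 <= t - s by rewrite subr_ge0.
have /(lipschitz_fine betaF beta_lip ts0) : t - s <= t + h - s by lra.
have -> : t + h - s - (t - s) = h by lra.
lra.
Qed.

Lemma good_arrival n t : (n <= N)%N -> 0 <= t -> t <= a n -> good t (P n).
Proof.
move=> nN t0 ta; exists t; first by rewrite t0 lexx.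
by rewrite subrr; case: betaF => -> _ _; rewrite add0r arr_le.
Qed.

(** Packet [n] may be held back only while the guarantee holds with the bits of its predecessors
    alone. *)
Hypothesis good_floor :
  forall n t, (n < N)%N -> 0 <= t -> t <= b n -> good t (P n).

Lemma good_start n : (n < N)%N -> good (fifo_start n) (P n).
Proof.
have ab m : (m < N)%N -> good (Num.max (a m) (b m)) (P m).
  move=> mN; case: (leP (a m) (b m)) => ab.
    by apply: good_floor => //; exact: le_trans ab.
  by apply: good_arrival => //; exact: ltnW.
elim: n => [|n IH] nN /=.
  by rewrite (max_idPl _) ?le_max ?a_ge0 //; exact: ab.
case: (leP _ (fifo_start n + _)) => _; last exact: ab.
have -> : P n.+1 = P n + c * (l n / c).
  by rewrite mulrCA divff ?gt_eqF // mulr1 /P big_ord_recr.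
by apply: good_lipschitz (IH (ltnW nN)); rewrite divr_ge0 // ltW.
Qed.

(** Either [t] precedes the release of the next packet ([gap]), or a packet is in transmission
    ([busy]), or all have left ([final], with [s = t]); [upto] sorts the times before a start by
    induction on the packets. *)
Lemma fifo_server_offers : offers_service_curve c fifo_server beta.
Proof.
suff H t : 0 <= t -> good t (dep t).
  move=> t /H [s st sp]; exists s => //.
  have ts0 : 0 <= t - s by rewrite subr_ge0; case/andP: st.
  rewrite cumul_arrivedE cumul_departedE.
  by rewrite -(fineK (lipschitz_fin betaF beta_lip ts0)) -EFinD lee_fin.
move=> t0; have goodW p : p <= dep t -> good t p -> good t (dep t).
  by move=> pd [s st sp]; exists s => //; exact: le_trans pd.
have gap n : (n < N)%N ->
    (forall m, (m < n)%N -> fifo_start m + l m / c <= t) ->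
    t <= Num.max (a n) (b n) -> good t (dep t).
  move=> nN Dt; rewrite le_max => tab; apply: (goodW (P n)).
    by apply: dep_ge => //; exact: ltnW.
  by case/orP: tab => [/good_arrival|/good_floor]; apply => //; exact: ltnW.
have busy n : (n < N)%N -> fifo_start n <= t -> t <= fifo_start n + l n / c ->
    good t (dep t).
  move=> nN Qt tD; apply: goodW (dep_ge_in_service nN Qt tD) _.
  have := good_lipschitz (_ : 0 <= t - fifo_start n) (good_start nN).
  by rewrite subr_ge0 addrCA subrr addr0; apply.
have Dt n : fifo_start n + l n / c < t ->
    forall m, (m < n.+1)%N -> fifo_start m + l m / c <= t.
  move=> nt m; rewrite ltnS leq_eqVlt => /orP[/eqP->|/departure_le mn].
    exact: ltW.
  apply: le_trans mn (le_trans _ (ltW nt)).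
  by rewrite lerDl divr_ge0 // ltW.
have upto n : (n < N)%N -> t <= fifo_start n -> good t (dep t).
  elim: n => [|n IH] nN /=.
    rewrite (max_idPl _) => [tab|]; last by rewrite le_max a_ge0.
    by apply: (gap 0).
  rewrite le_max => /orP[tab|tD]; have nN' := ltnW nN.
    case: (leP t (fifo_start n)) => [/IH|/ltW Qt]; first exact.
    case: (leP t (fifo_start n + l n / c)) => [|/Dt nt]; first exact: busy.
    by apply: (gap n.+1).
  case: (leP t (fifo_start n)) => [/IH|/ltW Qt]; first exact.
  exact: busy tD.
have final : P N <= dep t -> good t (dep t).
  move=> PN; apply: goodW PN _; exists t; first by rewrite t0 lexx.
  rewrite subrr; case: betaF => -> _ _; rewrite add0r /arr /P.
  rewrite [leRHS](bigID (fun m : 'I_N => a m < t)) lerDl /= sumr_ge0 // => m _.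
  exact: ltW.
case E : N => [|n].
  by apply: final; rewrite dep_ge ?E.
have nN : (n < N)%N by rewrite E.
case: (leP t (fifo_start n)) => [/upto|/ltW Qt]; first exact.
case: (leP t (fifo_start n + l n / c)) => [|/Dt nt]; first exact: busy.
by apply: final; apply: dep_ge => //; rewrite E.
Qed.

End service.
End server.

(** * Burst times of a single flow *)

Lemma uniq_subset1_size (T : eqType) (s : seq T) :
  uniq s -> {in s &, forall x y, x = y} -> (size s <= 1)%N.
Proof.
case: s => [|x [|y s]] //= /andP[xys _] /(_ x y).
by rewrite !inE !eqxx orbT /= => /(_ isT isT) xy; rewrite xy inE eqxx in xys.
Qed.

Section bursts.
Variable R : realType.
Implicit Types (tau t d A : R) (n K : nat).

Lemma count_ltD (s : seq R) t u : t <= u ->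
  count (fun x => x < u) s =
  (count (fun x => (x < t)%R) s + count (fun x => (t <= x < u)%R) s)%N.
Proof.
move=> tu; elim: s => //= x s ->; case: (ltP x t) => [xt|tx] /=.
  by rewrite (lt_le_trans xt tu) addnA.
by rewrite addnCA add0n.
Qed.

Definition grid tau (T0 : R) n : seq R := [seq T0 - j%:R * tau | j <- iota 0 n].

Lemma count_grid_ge tau (T0 : R) n A : 0 < tau -> A <= T0 ->
  (count (fun x => (A <= x)%R) (grid tau T0 n) <=
     (Num.truncn ((T0 - A) / tau)).+1)%N.
Proof.
move=> tau0 AT0; rewrite count_map -size_filter -(size_iota 0 _.+1).
apply: uniq_leq_size; first by rewrite filter_uniq ?iota_uniq.
move=> j; rewrite mem_filter !mem_iota /= => /andP[Aj _].
rewrite add0n ltnS truncn_ge_nat; last by rewrite divr_ge0 ?subr_ge0 // ltW.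
by rewrite ler_pdivlMr //; lra.
Qed.

(** Grid points are [tau] apart, and the window is half-open. *)
Lemma count_grid_window tau (T0 : R) n t : 0 < tau ->
  (count (fun x => (t <= x < t + tau)%R) (grid tau T0 n) <= 1)%N.
Proof.
move=> tau0; rewrite count_map -size_filter; apply: uniq_subset1_size.
  by rewrite filter_uniq ?iota_uniq.
suff H (j j' : nat) : t <= T0 - j'%:R * tau -> T0 - j%:R * tau < t + tau ->
    (j' <= j)%N.
  move=> j j'; rewrite !mem_filter /=.
  move=> /andP[/andP[tj jt] _] /andP[/andP[tj' j't] _].
  by apply/eqP; rewrite eqn_leq !H.
move=> tj' jt; rewrite -ltnS -(ltr_nat R) -(ltr_pM2r tau0) -natr1 mulrDl mul1r.
lra.
Qed.

(* A window of a Fixed interval constraint is half-open, so that a second burst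
   can come arbitrarily soon after one sent at the end of a window: the extra
   burst precedes the interval [T0 - t0, T0] of the regular ones by d. *)
Definition burst_times k tau (t0 T0 : R) d : seq R :=
  (if k is Fixed then [:: T0 - t0 - d] else [::]) ++
  grid tau T0 (Num.truncn (t0 / tau)).+1.

Lemma burst_sizeE k tau K (t0 T0 : R) d :
  burst_size k tau K t0 = (K * size (burst_times k tau t0 T0 d))%N.
Proof. by rewrite /burst_times size_cat size_map size_iota; case: k. Qed.

(** The extra burst of a Fixed flow is covered by the extra [K] of its curve, for every [A] and not
    only near [T0 - t0]; this serves the upper bound on the response time. *)
Lemma count_burst_times_ge k tau K (t0 T0 : R) d A : 0 < tau -> A <= T0 ->
  (K * count (fun x => (A <= x)%R) (burst_times k tau t0 T0 d) <=
     burst_size k tau K (T0 - A))%N.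
Proof.
move=> tau0 AT0; rewrite leq_mul2l count_cat leq_add ?orbT //.
  by case: k => //=; rewrite addn0; case: (_ <= _).
exact: count_grid_ge.
Qed.

Lemma grid_bounds tau (t0 T0 : R) x : 0 < tau -> 0 <= t0 ->
  x \in grid tau T0 (Num.truncn (t0 / tau)).+1 ->
  T0 - (Num.truncn (t0 / tau))%:R * tau <= x <= T0 /\ T0 - t0 <= x.
Proof.
move=> tau0 t00 /mapP[j]; rewrite mem_iota add0n ltnS /= => jn ->.
have jn' : j%:R * tau <= (Num.truncn (t0 / tau))%:R * tau.
  by rewrite ler_pM2r // ler_nat.
have nt0 : (Num.truncn (t0 / tau))%:R * tau <= t0.
  by rewrite -ler_pdivlMr // truncn_le divr_ge0 // ltW.
have j0 : 0 <= j%:R * tau by rewrite mulr_ge0 // ltW.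
by split; [apply/andP; split; lra | lra].
Qed.

Lemma burst_times_bounds k tau (t0 T0 : R) d x : 0 < tau -> 0 <= t0 -> 0 <= d ->
  x \in burst_times k tau t0 T0 d -> T0 - t0 - d <= x <= T0.
Proof.
move=> tau0 t00 d0; rewrite mem_cat => /orP[|].
  by case: k; rewrite ?inE // => /eqP->; apply/andP; split; lra.
by move=> /(grid_bounds tau0 t00)[/andP[_ xT] tx]; apply/andP; split; lra.
Qed.

Lemma burst_times_last k tau (t0 T0 : R) d : T0 \in burst_times k tau t0 T0 d.
Proof. by rewrite mem_cat /grid /= mul0r subr0 inE eqxx orbT. Qed.

Lemma burst_times_conform k tau K (t0 T0 : R) d : 0 < tau -> 0 <= t0 -> 0 < d ->
  t0 + d <= (Num.truncn (t0 / tau)).+1%:R * tau ->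
  (Num.truncn (t0 / tau)).+1%:R * tau <= T0 ->
  conforms k tau K (fun t =>
    (K * count (fun x => (x < t)%R) (burst_times k tau t0 T0 d))%:R%:E).
Proof.
move=> tau0 t00 d0 dtau T0ge.
have window t : (count (fun x => (t <= x < t + tau)%R)
      (burst_times k tau t0 T0 d) <= 1)%N ->
    (((K * count (fun x => (x < t + tau)%R)
        (burst_times k tau t0 T0 d))%:R)%:E -
     ((K * count (fun x => (x < t)%R)
        (burst_times k tau t0 T0 d))%:R)%:E <= (K%:R : R)%:E)%E.
  move=> w; rewrite (@count_ltD _ t (t + tau)); last by rewrite lerDl ltW.
  rewrite mulnDr natrD.
  rewrite EFinD addeAC subee // add0e lee_fin ler_nat.
  by rewrite -[leqRHS]muln1 leq_mul2l w orbT.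
case: k window => window; rewrite /conforms.
  by move=> t _; apply: window; exact: count_grid_window.
set n := Num.truncn (t0 / tau) in dtau T0ge *.
have nt0 : n%:R * tau <= t0.
  by rewrite -ler_pdivlMr // truncn_le divr_ge0 // ltW.
have nS : n.+1%:R * tau = n%:R * tau + tau by rewrite -natr1 mulrDl mul1r.
(* With this offset the earliest grid burst opens the second window, leaving the extra burst alone
   in the first. *)
exists (T0 - n.+1%:R * tau); first by rewrite subr_ge0.
have none t : t <= T0 - n.+1%:R * tau ->
    count (fun x => (x < t)%R) (burst_times Fixed tau t0 T0 d) = 0%N.
  move=> tT; apply/eqP; rewrite -leqn0 leqNgt -has_count -all_predC.
  apply/allP => x; rewrite /= -leNgt mem_cat inE => /orP[/eqP->|]; first lra.
  by move=> /(grid_bounds tau0 t00)[/andP[]]; rewrite -/n => ? _ _; lra.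
split=> [||i].
- by rewrite none // muln0.
- by rewrite none ?muln0 // subr_ge0.
have -> : T0 - n.+1%:R * tau + i.+1%:R * tau =
    T0 - n.+1%:R * tau + i%:R * tau + tau.
  by rewrite -[i.+1%:R]natr1 mulrDl mul1r addrA.
apply: window; set t := T0 - _ + _.
rewrite count_cat [X in (X + _ <= 1)%N]/= addn0.
case: (boolP (_ <= _ < _)) => [/andP[td dt]|_]; last first.
  by rewrite add0n; exact: count_grid_window.
rewrite add1n ltnS leqn0.
(* Later windows start at [T0 - n * tau] or after, hence after the extra burst. *)
have i0 : i = 0%N.
  case: i @t td dt => // i; rewrite /= => td _; exfalso.
  have : 0 <= i%:R * tau by rewrite mulr_ge0 // ltW.
  by move: td; rewrite nS -natr1 mulrDl mul1r; lra.
rewrite -leqn0 leqNgt -has_count -all_predC; apply/allP => x.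
move=> /(grid_bounds tau0 t00)[/andP[]]; rewrite -/n => nx _ _ /=.
rewrite negb_and -leNgt; apply/orP; right.
by rewrite /t i0 mul0r addr0 nS; lra.
Qed.

End bursts.

(** * The packets of all flows *)

Section packets.
Variables (R : realType) (M : nat) (K : 'I_M -> nat) (times : 'I_M -> seq R).

Definition packets : seq ('I_M * R) :=
  flatten [seq flatten [seq nseq (K i) (i, x) | x <- times i] | i <- enum 'I_M].

Lemma mem_packets i x : (0 < K i)%N -> x \in times i -> (i, x) \in packets.
Proof.
move=> Ki xi; apply/flatten_mapP; exists i; first by rewrite mem_enum.
by apply/flatten_mapP; exists x => //; rewrite mem_nseq Ki eqxx.
Qed.

Lemma packets_times q : q \in packets -> q.2 \in times q.1.
Proof.
move=> /flatten_mapP[i _ /flatten_mapP[x xi]].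
by rewrite mem_nseq => /andP[_ /eqP->].
Qed.

(** Used with [F = Lmax] to add up bits and with [F = 1] to count the packets of a flow. *)
Lemma sum_packets (F : 'I_M -> R) (p : 'I_M -> pred R) :
  \sum_(q <- packets | p q.1 q.2) F q.1 =
  \sum_i F i * (K i * count (p i) (times i))%:R.
Proof.
rewrite /packets big_flatten big_map big_enum /=; apply: eq_bigr => i _.
rewrite big_flatten big_map /= natrM mulrCA mulrC -sum1_count natr_sum.
rewrite mulr_sumr mulr_suml [RHS]big_mkcond; apply: eq_bigr => x _.
rewrite big_nseq_cond /=; case: (p i x) => //.
by rewrite iter_addr_0 mulr1 mulr_natr.
Qed.

End packets.

(** * Horizontal deviation of the aggregate curve *)

Definition total_burst (R : realType) (M : nat) (kind : 'I_M -> interval_kind)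
    (tau : 'I_M -> R) (K : 'I_M -> nat) (Lmax : 'I_M -> R) (t : R) : R :=
  \sum_i Lmax i * (burst_size (kind i) (tau i) (K i) t)%:R.

Lemma hdev_total_burst (R : realType) (M : nat) (beta : R -> \bar R)
    (kind : 'I_M -> interval_kind) (tau : 'I_M -> R) (K : 'I_M -> nat)
    (Lmax : 'I_M -> R) (y : R) : (forall i, 0 < tau i) ->
  hdev (fun t => \sum_(i < M)
          (Lmax i)%:E * right_limit (alpha_pkt (kind i) (tau i) (K i)) t
          - y%:E)%E beta =
  ereal_sup [set (lower_pseudo_inverse beta
                    (total_burst kind tau K Lmax t - y)%:E - t%:E)%E
            | t in [set t : R | 0 <= t]].
Proof.
move=> tau0; congr ereal_sup; apply: eq_imagel => t /= t0.
rewrite EFinB /total_burst -sumEFin.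
under eq_bigr do rewrite right_limit_alpha_pkt //.
by [].
Qed.

Lemma total_burst_ge (R : realType) (M : nat) (kind : 'I_M -> interval_kind)
    (tau : 'I_M -> R) (K : 'I_M -> nat) (Lmax : 'I_M -> R) (f : 'I_M) (t : R) :
  (forall i, 0 < Lmax i) -> (0 < K f)%N ->
  Lmax f <= total_burst kind tau K Lmax t.
Proof.
move=> L0 Kf; rewrite /total_burst (bigD1 f) //= -[leLHS]addr0 lerD //.
  rewrite -[leLHS]mulr1 ler_pM2l // ler1n /burst_size muln_gt0 Kf.
  by rewrite addn_gt0 orbT.
by apply: sumr_ge0 => i _; rewrite mulr_ge0 // ltW.
Qed.

(** The supremum is finite: its term at [t = 0] is nonnegative. Then [t0] almost attains it, and [x]
    is finite because [x - t0] is at most [H]. *)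
Lemma Delta_pkt_witness (R : realType) (M : nat) (c : R) (beta : R -> \bar R)
    (kind : 'I_M -> interval_kind) (tau : 'I_M -> R) (K : 'I_M -> nat)
    (Lmax : 'I_M -> R) (f : 'I_M) (e : R) :
  0 < c -> Finc0 beta -> lipschitz_curve c beta -> (forall i, 0 < tau i) ->
  (Delta_pkt c beta kind tau K Lmax f < +oo)%E -> 0 < e ->
  exists H t0 x : R,
    [/\ Delta_pkt c beta kind tau K Lmax f = (H + Lmax f / c)%:E,
        0 <= t0, H - e < x - t0 <= H,
        lower_pseudo_inverse beta
          (total_burst kind tau K Lmax t0 - Lmax f)%:E = x%:E &
        forall u, 0 <= u ->
          (total_burst kind tau K Lmax u - Lmax f) / c - u <= H].
Proof.
move=> c0 bF lip tau0; rewrite /Delta_pkt hdev_total_burst //.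
set W := total_burst _ _ _ _; set S := [set _ | _ in _] => Dfin e0.
have inS u : 0 <= u ->
    S (lower_pseudo_inverse beta (W u - Lmax f)%:E - u%:E)%E by exists u.
have supge u (u0 : 0 <= u) := ereal_sup_ubound (inS u u0).
have Sfin : ereal_sup S \is a fin_num.
  rewrite fin_numE; apply/andP; split; apply/eqP => SE.
    have := supge 0 (lexx 0); rewrite SE leeNy_eq sube0 => /eqP LE.
    by have := lower_pseudo_inverse_ge0 beta (W 0 - Lmax f)%:E; rewrite LE.
  by move: Dfin; rewrite SE.
have SE := esym (fineK Sfin); set H := fine _ in SE.
have [_ [t0 t00 <-]] := ub_ereal_sup_adherent e0 Sfin.
have /= := supge _ t00.
have := lower_pseudo_inverse_ge0 beta (W t0 - Lmax f)%:E.
rewrite SE; case E : lower_pseudo_inverse => [x| |] // _.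
rewrite -!EFinB lte_fin lee_fin => xH Hx.
exists H, t0, x; split=> //; first by rewrite Hx xH.
move=> u u0; rewrite -lee_fin -SE EFinB.
by apply: le_trans (supge u u0); rewrite leeD2r // lower_pseudo_inverse_ge.
Qed.

(** * The worst-case trace *)

Theorem theorem3 (R : realType) (M : nat) (c : R) (beta : R -> \bar R)
    (kind : 'I_M -> interval_kind) (tau : 'I_M -> R) (K : 'I_M -> nat)
    (Lmax : 'I_M -> R)
    (c_gt0 : 0 < c)
    (beta_Finc0 : Finc0 beta)
    (beta_lip : lipschitz_curve c beta)
    (tau_gt0 : forall i, 0 < tau i)
    (K_gt0 : forall i, (0 < K i)%N)
    (Lmax_gt0 : forall i, 0 < Lmax i)
    (f : 'I_M)
    (Delta_fin : (Delta_pkt c beta kind tau K Lmax f < +oo)%E)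
    (eps : R) (eps_gt0 : 0 < eps) :
  exists T : trace R M,
    [/\ fifo_trace c T,
        offers_service_curve c T beta,
        (forall i, conforms (kind i) (tau i) (K i) (npackets T i)),
        (forall n, is_packet T n -> len T n <= Lmax (flow_of T n)) &
        exists n : nat,
          [/\ is_packet T n,
              flow_of T n = f,
              (Delta_pkt c beta kind tau K Lmax f - eps%:E
                 <= (response_time c T n)%:E)%E &
              ((response_time c T n)%:E
                 <= Delta_pkt c beta kind tau K Lmax f)%E]].
Proof.
(* One half of [eps] pays for the choice of [t0], the other for [d]. *)
have eps2 : 0 < eps / 2 by rewrite divr_gt0.
have [H [t0 [x [-> t0_ge0 /andP[Hx xH] betax W_le]]]] :=
  Delta_pkt_witness c_gt0 beta_Finc0 beta_lip tau_gt0 Delta_fin eps2.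
have x_ge0 : 0 <= x by rewrite -lee_fin -betax lower_pseudo_inverse_ge0.
pose W := total_burst kind tau K Lmax; rewrite -/W in betax W_le.
(* The first multiple of [tau i] beyond [t0]; with [d <= next i - t0] the extra burst of a Fixed
   flow stays in the window just before its grid. *)
pose next i := (Num.truncn (t0 / tau i)).+1%:R * tau i.
have next_gt i : 0 < next i - t0.
  by rewrite subr_gt0 -ltr_pdivrMr // truncnS_gt.
have next_le i : next i <= t0 + tau i.
  rewrite /next -natr1 mulrDl mul1r lerD2r -ler_pdivlMr // truncn_le.
  by rewrite divr_ge0 // ltW.
pose d := \big[Num.min/eps / 2]_i (next i - t0).
have d_gt0 : 0 < d by rewrite lt_bigmin.
have d_eps : d <= eps / 2 by exact: bigmin_le_id.
have d_next i : d <= next i - t0 by exact: bigmin_le_cond.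
(* Late enough for [next i <= T0], so that offsets and arrival times are nonnegative. *)
pose T0 := t0 + \sum_i tau i.
have tau_sum i : t0 + tau i <= T0.
  rewrite lerD2l (bigD1 i) //= lerDl.
  by apply: sumr_ge0 => j _; exact: ltW.
pose s1 := T0 - t0 - d.
have s1_ge0 : 0 <= s1.
  have := d_next f; have := next_le f; have := tau_sum f; rewrite /s1; lra.
have s1T0 : s1 <= T0 by rewrite /s1; lra.
pose times i := burst_times (kind i) (tau i) t0 T0 d.
pose tagged := (f, T0); pose S := packets K times.
have tagS : tagged \in S by apply: mem_packets => //; exact: burst_times_last.
(* The tagged packet is set aside and put back last, which respects the order since no packet
   arrives after [T0]. *)
pose S0 := sort (fun q r : 'I_M * R => q.2 <= r.2) (rem tagged S).
have S0S : perm_eq (rcons S0 tagged) S.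
  rewrite perm_rcons perm_sym (permPl (perm_to_rem tagS)) perm_cons.
  by rewrite perm_sym perm_sort.
(* The default value of [nth] makes [pkt n0] the tagged packet. *)
pose n0 := size S0; pose pkt := nth tagged S0.
have pktE n : nth tagged (rcons S0 tagged) n = pkt n.
  rewrite nth_rcons /pkt; case: ltnP => // nS; rewrite nth_default //.
  by case: eqP.
have pkt_tagged n : (n0 <= n)%N -> pkt n = tagged by exact: nth_default.
have pkt_bounds n : s1 <= (pkt n).2 <= T0.
  have : pkt n \in S.
    case: (ltnP n n0) => [nS|/pkt_tagged->] //.
    by rewrite -(perm_mem S0S) mem_rcons inE mem_nth ?orbT.
  move=> /packets_times; apply: burst_times_bounds => //; exact: ltW.
pose l n := Lmax (pkt n).1; pose a n := (pkt n).2.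
pose b n := if n == n0 then s1 + x else 0.
have l_gt0 n : 0 < l n by exact: Lmax_gt0.
have a_ge0 n : 0 <= a n by have /andP[/(le_trans s1_ge0)] := pkt_bounds n.
have a_homo n : a n <= a n.+1.
  case: (ltnP n.+1 n0) => [nS|/pkt_tagged]; rewrite /a; last first.
    by move=> ->; have /andP[] := pkt_bounds n.
  have /(sortedP tagged) := sort_sorted
    (fun q r : 'I_M * R => le_total q.2 r.2) (rem tagged S).
  exact.
have sumE (p : pred ('I_M * R)) (F : 'I_M * R -> R) :
    \sum_(n < n0.+1 | p (pkt n)) F (pkt n) = \sum_(q <- S | p q) F q.
  rewrite -(perm_big _ S0S) (big_nth tagged) size_rcons big_mkord.
  by apply: eq_big => [n|n _]; rewrite pktE.
have sum0E : \sum_(m < n0) l m = W t0 - Lmax f.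
  have := sumE xpredT (fun q => Lmax q.1); rewrite big_ord_recr /=.
  rewrite pkt_tagged //= (sum_packets K times Lmax (fun _ => xpredT)).
  move/(canRL (addrK _)) => ->; congr (_ - _); apply: eq_bigr => i _.
  by rewrite count_predT /times -burst_sizeE.
have sum_geE A : A <= T0 -> \sum_(q <- S | A <= q.2) Lmax q.1 <= W (T0 - A).
  move=> AT0; rewrite (sum_packets K times Lmax (fun _ y => A <= y)).
  apply: ler_sum => i _; rewrite ler_pM2l // ler_nat.
  exact: count_burst_times_ge.
(* Packets [m] to [n0] all arrive in [[a m, T0]]; the size of the tagged one is then deducted. *)
have backlog m : (m <= n0)%N ->
    \sum_(k < n0) l k - \sum_(k < m) l k <= W (T0 - a m) - Lmax f.
  move=> mn; have /andP[_ amT] := pkt_bounds m.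
  apply: le_trans (lerB (sum_geE _ amT) (lexx _)).
  rewrite -(sumE (fun q => a m <= q.2) (fun q => Lmax q.1)).
  rewrite [X in _ <= X - _]big_mkcond big_ord_recr /= (arrival_homo a_homo mn).
  rewrite pkt_tagged //.
  rewrite addrK lerBlDr (big_ord_widen n0 l mn).
  rewrite [leLHS](bigID (fun k : 'I_n0 => (k < m)%N)) /= addrC lerD2r.
  rewrite big_mkcond; apply: ler_sum => k _; case: ifPn => [|_]; last first.
    by case: ifP => // _; exact: ltW.
  by rewrite -leqNgt => /(arrival_homo a_homo) ->.
pose T := fifo_server c n0.+1 (fun n => (pkt n).1) l a b.
have response : response_time c T n0 =
    fifo_start c l a b n0 + Lmax f / c - T0.
  by rewrite /response_time /departure /= /l /a pkt_tagged.
exists T; split.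
- by apply: fifo_server_fifo.
- apply: fifo_server_offers => // n t; rewrite ltnS => nN t_ge0.
  have early : t <= s1 -> exists2 s, 0 <= s <= t &
      fine (beta (t - s)) + \sum_(m < n0.+1 | a m < s) l m <= \sum_(m < n) l m.
    move=> ts; exists t; first by rewrite t_ge0 lexx.
    rewrite subrr; case: beta_Finc0 => -> _ _.
    rewrite arr_eq0 => [|m].
      by rewrite addr0 sumr_ge0 // => m _; exact: ltW.
    by have /andP[+ _] := pkt_bounds m; exact: le_trans.
  (* Up to [s1] nothing has arrived and [s = t] works; from [s1] to [s1 + x], take [s = s1], as
     [beta] stays below the bits ahead of the tagged packet. *)
  rewrite /b; case: eqP => [nE|_] tb; last exact: early (le_trans tb s1_ge0).
  case: (leP t s1) => [/early //|/ltW s1t].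
  exists s1; first by rewrite s1_ge0.
  rewrite arr_eq0 ?addr0 => [|m]; last by have /andP[] := pkt_bounds m.
  rewrite nE sum0E.
  apply: (beta_lower_pseudo_inverse_le c_gt0 beta_Finc0 beta_lip _ betax).
  + by rewrite subr_ge0 total_burst_ge.
  + by rewrite subr_ge0.
  + by rewrite lerBlDl.
- move=> i; have -> : npackets T i = fun t =>
      (K i * count (fun y => (y < t)%R) (times i))%:R%:E.
    apply/funext => t; rewrite npacketsE; congr EFin.
    rewrite (sumE (fun q => (q.1 == i) && (q.2 < t)) (fun=> 1)).
    rewrite (sum_packets K times (fun=> 1) (fun j y => (j == i) && (y < t))).
    rewrite (bigD1 i) //= eqxx mul1r big1 ?addr0 // => j /negPf ji.
    by rewrite mul1r ji count_pred0 muln0.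
  apply: burst_times_conform => //; first by rewrite -lerBrDl d_next.
  exact: le_trans (next_le i) (tau_sum i).
- by [].
exists n0; rewrite response; split.
- by rewrite /is_packet /= ltnSn.
- by rewrite /= pkt_tagged.
- rewrite -EFinB lee_fin.
  have : s1 + x <= fifo_start c l a b n0.
    by apply: le_trans (fifo_start_ge_floor _ _ _ _ _); rewrite /b eqxx.
  rewrite /s1; lra.
- rewrite lee_fin.
  suff : fifo_start c l a b n0 <= T0 + H by lra.
  (* The deadlines for arrivals come from [backlog] and [W_le]; the floor of the tagged packet meets
     its own because [x - t0 <= H]. *)
  apply: (@fifo_start_le _ c n0.+1) => // m mn.
  have /andP[_ amT] := pkt_bounds m.
  have am : a m <= T0 + H -
      (\sum_(k < n0) l k - \sum_(k < m) l k) / c.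
    have := W_le (T0 - a m); rewrite subr_ge0 => /(_ amT).
    have : (\sum_(k < n0) l k - \sum_(k < m) l k) / c <=
        (W (T0 - a m) - Lmax f) / c.
      by rewrite ler_pM2r ?invr_gt0 // backlog.
    lra.
  split=> //; rewrite /b; case: eqP => [->|_]; last exact: le_trans am.
  by rewrite subrr mul0r subr0 /s1; lra.
Qed.
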